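(* For any integer $n\geq 1$ let $u(n)$ be the number of weak orderings $\precsim$ on $X_n$ that are weakly single-peaked for $\leq_n$, and set $u(0)=0$. The sequence $(u(n))_{n\geq 0}$ satisfies the second order linear recurrence equation $$u(n+2)-2\,u(n+1)-u(n)=1,\qquad n\geq 0,$$ with $u(0)=0$ and $u(1)=1$, and we have $$2\,u(n)+1=\tfrac{1}{2}(1+\sqrt{2})^{n+1}+\tfrac{1}{2}(1-\sqrt{2})^{n+1}=\sum_{k\geq 0}\binom{n+1}{2k}2^k,\qquad n\geq 0.$$ Moreover, its generating function is given by $U(z)=z/(z^3+z^2-3z+1)$.
   Context: $X_n=\{1,\ldots,n\}$ and $\leq_n$ is the total ordering on $X_n$ with $1<_n 2<_n\cdots<_n n$. A weak ordering $\precsim$ on $X$ is a total and transitive binary relation, with symmetric part $\sim$ ($x\sim y$ iff $x\precsim y$ and $y\precsim x$) and asymmetric part $\prec$ ($x\prec y$ iff $x\precsim y$ and not $y\precsim x$). Given a total ordering $\leq$ on $X$, a weak ordering $\precsim$ on $X$ is weakly single-peaked for $\leq$ if for any $a,b,c\in X$ such that $a<b<c$, we have $b\prec a$ or $b\prec c$ or $a\sim b\sim c$. The (ordinary) generating function of a sequence $(s_n)_{n\geq 0}$ is the power series $S(z)=\sum_{n\geq 0}s_n z^n$. *)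

(* Defs.v *)
From HB Require Import structures.
From mathcomp Require Import all_boot all_order all_algebra.

Set Implicit Arguments.
Unset Strict Implicit.
Unset Printing Implicit Defensive.

Import Order.TTheory GRing.Theory.

(* Binary relations on a finite type T are sets of pairs, so that they can be
   counted; [x R y] is [(x, y) \in R]. *)

Definition sympart (T : finType) (R : {set T * T}) (x y : T) : bool :=
  ((x, y) \in R) && ((y, x) \in R).

Definition asympart (T : finType) (R : {set T * T}) (x y : T) : bool :=
  ((x, y) \in R) && ((y, x) \notin R).

Definition weak_ordering (T : finType) (R : {set T * T}) : bool :=
  [forall x, forall y, ((x, y) \in R) || ((y, x) \in R)] &&
  [forall x, forall y, forall z,
     ((x, y) \in R) && ((y, z) \in R) ==> ((x, z) \in R)].

Definition weakly_single_peaked (d : Order.disp_t) (T : finOrderType d)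
    (R : {set T * T}) : bool :=
  [forall a : T, forall b : T, forall c : T,
     (a < b < c)%O ==>
     [|| asympart R b a, asympart R b c | sympart R a b && sympart R b c]].

(* X_n is 'I_n (shifted to start at 0) with its canonical order.  The value at
   0 is a convention: the empty relation on 'I_0 is not counted. *)
Definition u (n : nat) : nat :=
  if n is 0 then 0
  else #|[set R : {set 'I_n * 'I_n} |
          weak_ordering R && weakly_single_peaked R]|.

Local Open Scope ring_scope.

(* Formal power series as coefficient sequences. *)
Definition fps (K : Type) : Type := nat -> K.

Definition fps_of_poly (K : nzRingType) (p : {poly K}) : fps K :=
  fun n => p`_n.

Definition fps_mul (K : nzRingType) (f g : fps K) : fps K :=
  fun n => \sum_(i < n.+1) f i * g (n - i)%N.

(* [fps_inv_seq f n] lists the coefficients of index n, n - 1, ..., 0 of 1/f,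
   obtained by solving f * (1/f) = 1 degree by degree; meaningful only when
   f 0 is a unit. *)
Fixpoint fps_inv_seq (K : unitRingType) (f : fps K) (n : nat) : seq K :=
  if n is m.+1 then
    let s := fps_inv_seq f m in
    - ((f 0%N)^-1 * \sum_(i < m.+1) f i.+1 * s`_i) :: s
  else [:: (f 0%N)^-1].

Definition fps_inv (K : unitRingType) (f : fps K) : fps K :=
  fun n => (fps_inv_seq f n)`_0.

Definition fps_div (K : unitRingType) (f g : fps K) : fps K :=
  fps_mul f (fps_inv g).

Lemma nth_fps_inv_seq (K : unitRingType) (f : fps K) (n i : nat) :
  (i <= n)%N -> (fps_inv_seq f n)`_i = fps_inv f (n - i)%N.
Proof.
elim: n i => [|n IHn] [|i] //= le_in.
by rewrite IHn // subSS.
Qed.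

Lemma fps_mulfV (K : unitRingType) (f : fps K) :
  f 0%N \is a GRing.unit ->
  fps_mul f (fps_inv f) =1 fps_of_poly 1.
Proof.
move=> Uf [|n]; rewrite /fps_mul /fps_of_poly coef1.
  by rewrite big_ord_recl big_ord0 addr0 /fps_inv /= divrr.
rewrite big_ord_recl subn0 {1}/fps_inv /= mulrN mulrA divrr // mul1r.
apply/eqP; rewrite addrC subr_eq0; apply/eqP/eq_bigr => i _.
by rewrite nth_fps_inv_seq ?subSS // -ltnS ltn_ord.
Qed.

Definition ogf (K : nzRingType) (s : nat -> nat) : fps K :=
  fun n => (s n)%:R.

(* Main.v *)
(** The maximal class of a weakly single-peaked weak ordering on a finite chain
    A is either all of A or consists of endpoints of A only: a maximal element
    strictly between two others forces all of A to be equivalent to it.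
    Conversely, putting one or both endpoints strictly above a weakly
    single-peaked ordering of the remaining points gives a weakly single-peaked
    ordering.  Sorting the orderings by their maximal class (everything,
    {min}, {max} or {min, max}) gives u(n+2) = 1 + 2 u(n+1) + u(n); the other
    assertions follow from this recurrence. *)

Require Import Defs.
From mathcomp Require Import all_boot all_order all_algebra.
From mathcomp Require Import zify ring.

Set Implicit Arguments.
Unset Strict Implicit.
Unset Printing Implicit Defensive.

Import Order.TTheory GRing.Theory Num.Theory.

Lemma subset2 (T : finType) (A : {set T}) (x y : T) : A != set0 ->
  A \subset [set x; y] -> [|| A == [set x], A == [set y] | A == [set x; y]].
Proof.
move=> A0 sA.
have AE z : (z \in A) = (z == x) && (x \in A) || (z == y) && (y \in A).
  apply/idP/idP => [zA|/orP[]/andP[/eqP->]//].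
  by have /set2P[] := subsetP sA z zA => <-; rewrite eqxx zA ?orbT.
have xyA : (x \in A) || (y \in A).
  by case/set0Pn: A0 => t; rewrite AE => /orP[]/andP[_ ->]; rewrite ?orbT.
have [xA|nxA] := boolP (x \in A); last first.
  move: xyA; rewrite (negPf nxA) /= => yA.
  apply/or3P; apply: Or32; apply/eqP/setP => z.
  by rewrite AE yA (negPf nxA) !inE andbF andbT.
apply/or3P; have [yA|nyA] := boolP (y \in A); [apply: Or33|apply: Or31].
  by apply/eqP/setP => z; rewrite AE xA yA !inE !andbT.
by apply/eqP/setP => z; rewrite AE xA (negPf nyA) !inE andbT andbF orbF.
Qed.

(** * Weakly single-peaked orderings of the subsets of a chain *)

Section WeaklySinglePeakedOn.
Variables (d : Order.disp_t) (T : finOrderType d).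
Implicit Types (A B C : {set T}) (R S : {set T * T}).

(* Orderings of a subset A are relations included in A x A, so that all subsets
   share one type of relations.  As for [u], the empty relation on the empty
   set is not counted. *)
Definition wsp_on A : {set {set T * T}} :=
  [set R : {set T * T} | [&& A != set0, R \subset setX A A,
    [forall x in A, forall y in A, ((x, y) \in R) || ((y, x) \in R)],
    [forall x, forall y, forall z,
      ((x, y) \in R) && ((y, z) \in R) ==> ((x, z) \in R)] &
    [forall a in A, forall b in A, forall c in A, (a < b < c)%O ==>
      [|| asympart R b a, asympart R b c | sympart R a b && sympart R b c]]]].

Lemma wsp_onP A R :
  reflect [/\ A != set0, {subset R <= setX A A},
    {in A &, forall x y, ((x, y) \in R) || ((y, x) \in R)},
    (forall x y z, (x, y) \in R -> (y, z) \in R -> (x, z) \in R) &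
    {in A & &, forall a b c, (a < b)%O -> (b < c)%O ->
      [|| asympart R b a, asympart R b c | sympart R a b && sympart R b c]}]
   (R \in wsp_on A).
Proof.
rewrite inE; apply: (iffP and5P) => -[A0 sRA tot tr wsp]; split => //.
- exact/subsetP.
- by move=> x y xA yA; apply: (forall_inP (forall_inP tot x xA) y yA).
- move=> x y z xy yz.
  by have /forallP/(_ y)/forallP/(_ z)/implyP := forallP tr x; apply; apply/andP.
- move=> a b c aA bA cA ab bc.
  have := forall_inP (forall_inP (forall_inP wsp a aA) b bA) c cA.
  by rewrite ab bc.
- exact/subsetP.
- by apply/forall_inP => x xA; apply/forall_inP => y yA; apply: tot.
- apply/forallP => x; apply/forallP => y; apply/forallP => z.
  by apply/implyP => /andP[]; apply: tr.
- apply/forall_inP => a aA; apply/forall_inP => b bA; apply/forall_inP => c cA.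
  by apply/implyP => /andP[]; apply: wsp.
Qed.

Lemma wsp_on_set0 : wsp_on set0 = set0.
Proof. by apply/setP => R; rewrite !inE eqxx. Qed.

Lemma wsp_on_setT : [set: T] != set0 ->
  wsp_on setT = [set R | weak_ordering R && weakly_single_peaked R].
Proof.
move=> T0; apply/setP => R; rewrite [RHS]inE; apply/wsp_onP/idP.
  case=> _ _ tot tr wsp; apply/andP; split; first (apply/andP; split).
  - by apply/forallP => x; apply/forallP => y; apply: tot.
  - apply/forallP => x; apply/forallP => y; apply/forallP => z.
    by apply/implyP => /andP[]; apply: tr.
  - apply/forallP => a; apply/forallP => b; apply/forallP => c.
    by apply/implyP => /andP[ab bc]; apply: wsp.
case/andP=> /andP[/forallP tot /forallP tr] /forallP wsp; split=> //.
- by case=> x y _; rewrite !inE.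
- by move=> x y _ _; apply: (forallP (tot x)).
- move=> x y z xy yz.
  by have /forallP/(_ y)/forallP/(_ z)/implyP := tr x; apply; apply/andP.
- move=> a b c _ _ _ ab bc.
  have /forallP/(_ b)/forallP/(_ c)/implyP := wsp a; apply.
  by rewrite ab bc.
Qed.

(** * The maximal class *)

Definition top_class A R : {set T} :=
  [set x in A | [forall y in A, (y, x) \in R]].

Lemma top_classP A R x :
  reflect (x \in A /\ {in A, forall y, (y, x) \in R}) (x \in top_class A R).
Proof. by rewrite inE; apply: (iffP andP) => -[xA /forall_inP]. Qed.

(** Take [x] in [A] with the most elements below it. If [y] were not below [x], totality and
    transitivity would give [y] strictly more elements below it. *)
Lemma top_class_neq0 A R : R \in wsp_on A -> top_class A R != set0.
Proof.
case/wsp_onP=> /set0Pn[x0 x0A] sRA tot tr _; apply/set0Pn.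
case: (arg_maxnP (fun x => #|[set y | (y, x) \in R]|) x0A) => x xA xmax.
exists x; apply/top_classP; split=> // y yA.
have /orP[//|xy] := tot y x yA xA; apply/contraT => nyx.
have /= := xmax y yA; rewrite leqNgt => /negP[]; apply: proper_card.
apply/properP; split.
  by apply/subsetP => z; rewrite !inE => zx; apply: tr zx xy.
by exists y; rewrite !inE //; have := tot y y yA yA; rewrite orbb.
Qed.

(** A maximal [x] is strictly below nothing, so between two points of [A] only the third alternative
    remains and all three are equivalent. Any [y] on one side of [x] is paired with [a] or [c] on
    the other side. *)
Lemma top_class_interior A R a x c : R \in wsp_on A ->
  x \in top_class A R -> a \in A -> c \in A -> (a < x)%O -> (x < c)%O ->
  top_class A R = A.
Proof.
case/wsp_onP=> _ sRA tot tr wsp /top_classP[xA xtop] aA cA ax xc.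
have below b e : b \in A -> e \in A -> (b < x)%O -> (x < e)%O ->
    ((x, b) \in R) && ((x, e) \in R).
  move=> bA eA bx xe; have := wsp b x e bA xA eA bx xe.
  rewrite /asympart /sympart !(xtop b, xtop e) // !andbF /=.
  by rewrite !andbT.
apply/setP => y; apply/idP/idP => [/top_classP[]//|yA].
suff xy : (x, y) \in R.
  by apply/top_classP; split=> // z zA; apply: tr xy; apply: xtop.
case: (ltgtP x y) => [xy|yx|<-]; last exact: xtop.
- by have /andP[] := below a y aA yA ax xy.
- by have /andP[] := below y c yA cA yx xc.
Qed.

(** * Counting orderings by their maximal class *)

Lemma wsp_on_full A : A != set0 -> setX A A \in wsp_on A.
Proof.
move=> A0; apply/wsp_onP; split=> //.
- by move=> x y xA yA; rewrite !inE xA yA.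
- by move=> x y z; rewrite !inE => /andP[-> _] /andP[_ ->].
- by move=> a b c aA bA cA _ _; rewrite /asympart /sympart !inE aA bA cA.
Qed.

Lemma card_top_class_full A : A != set0 ->
  #|[set R in wsp_on A | top_class A R == A]| = 1.
Proof.
move=> A0; apply/eqP/cards1P; exists (setX A A); apply/setP => R.
rewrite inE [RHS]inE; apply/andP/eqP => [[/wsp_onP[_ sRA _ _ _] /eqP topA]|->].
  apply/eqP; rewrite eqEsubset; apply/andP; split; first exact/subsetP.
  apply/subsetP => -[x y]; rewrite inE /= => /andP[xA].
  by rewrite -{1}topA => /top_classP[_]; apply.
split; first exact: wsp_on_full.
apply/eqP/setP => x; apply/top_classP/idP => [[]//|xA].
by split=> // y yA; rewrite inE yA xA.
Qed.

(** The map [f] adds to an ordering of [A :\: C] all pairs with second entry in [C], placing [C] as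
    one class strictly above the rest; restriction inverts it. The last hypothesis keeps points of
    [C] out of the middle position, so single-peakedness is only tested at points outside [C]. *)
Lemma card_top_class A C : C != set0 -> C \proper A ->
  (forall a x c, a \in A -> x \in C -> c \in A ->
     (a < x)%O -> (x < c)%O -> False) ->
  #|[set R in wsp_on A | top_class A R == C]| = #|wsp_on (A :\: C)|.
Proof.
move=> /set0Pn[t tC] /properP[/subsetP sCA [z zA zC]] ext.
have tA := sCA t tC.
pose f S := S :|: setX A C.
have sBA x : x \in A :\: C -> x \in A by rewrite inE => /andP[].
have sBC x : x \in A :\: C -> (x \in C) = false.
  by rewrite inE => /andP[/negPf].
have inB x : x \in A -> (x \in C) = false -> x \in A :\: C.
  by rewrite inE => -> ->.
have fE S x y : ((x, y) \in f S) = ((x, y) \in S) || (x \in A) && (y \in C).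
  by rewrite !inE.
have fB S x y : y \in A :\: C -> ((x, y) \in f S) = ((x, y) \in S).
  by move=> yB; rewrite fE (sBC y yB) andbF orbF.
rewrite -[RHS](card_in_imset (f := f)); last first.
  move=> S1 S2 /wsp_onP[_ s1 _ _ _] /wsp_onP[_ s2 _ _ _] eqf.
  (* [f] leaves pairs ending in [A :\: C] unchanged, and an ordering of [A :\: C] has no other
     pairs. *)
  apply/setP => -[x y]; case yB: (y \in A :\: C).
    by rewrite -(fB S1) // eqf fB.
  by apply/idP/idP => [/s1|/s2]; rewrite in_setX yB andbF.
apply: eq_card => R; apply/idP/imsetP.
  rewrite inE => /andP[/wsp_onP[A0 sRA tot tr wsp] /eqP topC].
  exists (R :&: setX (A :\: C) (A :\: C)); last first.
    apply/setP => -[x y]; rewrite fE in_setI in_setX.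
    case yC: (y \in C).
      rewrite andbT [y \in _ :\: _]inE yC /= !andbF /=; apply/idP/idP => [|xA].
        by case/sRA/setXP.
      by move: yC; rewrite -topC => /top_classP[_]; apply.
    (* If [x] were in [C], it would be maximal and below [y], so [y] would be maximal too, against
       [y] not in [C]. *)
    rewrite andbF orbF; case Rxy: (_ \in R) => //=; symmetry.
    have /setXP[/= xA yA] := sRA _ Rxy; rewrite !inE xA yA yC !andbT /=.
    apply/negP; rewrite -topC => /top_classP[_ xtop].
    move/negP: yC; apply; rewrite -topC; apply/top_classP; split=> // w wA.
    by apply: tr Rxy; apply: xtop.
  have memB x y : x \in A :\: C -> y \in A :\: C ->
      ((x, y) \in R :&: setX (A :\: C) (A :\: C)) = ((x, y) \in R).
    by move=> xB yB; rewrite in_setI in_setX /= xB yB !andbT.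
  apply/wsp_onP; split.
  - by apply/set0Pn; exists z; rewrite inE zA zC.
  - by move=> p /setIP[].
  - by move=> x y xB yB; rewrite !memB //; apply: tot; apply: sBA.
  - move=> x y w /setIP[xy /setXP[/= xB _]] /setIP[yw /setXP[/= _ wB]].
    by rewrite memB //; apply: tr xy yw.
  - move=> a b c aB bB cB ab bc; rewrite /asympart /sympart !memB //.
    by apply: wsp => //; apply: sBA.
case=> S /wsp_onP[B0 sSB tot tr wsp] ->.
have totf : {in A &, forall x y, ((x, y) \in f S) || ((y, x) \in f S)}.
  move=> x y xA yA; rewrite !fE xA yA /=.
  case xC: (x \in C); first by rewrite !orbT.
  case yC: (y \in C); first by rewrite !orbT.
  by rewrite !orbF; apply: tot; apply: inB.
have sfA : {subset f S <= setX A A}.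
  case=> x y; rewrite fE in_setX => /orP[/sSB/setXP[/= /sBA-> /sBA->]//|].
  by case/andP=> -> /sCA.
rewrite inE; apply/andP; split; last first.
  (* A maximal [x] outside [C] would lie above [t] in [C], but [f S] has no pair from [C] to its
     complement. *)
  apply/eqP/setP => x; apply/top_classP/idP => [[xA xtop]|xC].
    apply/contraT => /negPf xC; have := xtop t tA.
    by rewrite fB ?inB // => /sSB/setXP[/= /sBC]; rewrite tC.
  by split=> [|y yA]; [exact: sCA | rewrite fE yA xC orbT].
apply/wsp_onP; split=> //.
- by apply/set0Pn; exists z.
- move=> x y w xy; have /setXP[/= xA yA] := sfA _ xy.
  move=> yw; have /setXP[/= _ wA] := sfA _ yw.
  case wC: (w \in C); first by rewrite fE xA wC orbT.
  move: yw; rewrite !fB ?inB // => yw; have /setXP[/= yB _] := sSB _ yw.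
  by move: xy; rewrite fB // => xy; apply: tr xy yw.
- move=> a b c aA bA cA ab bc.
  have bB : b \in A :\: C.
    by apply: inB => //; apply/negP => bC; apply: (ext a b c).
  (* If [a] or [c] is in [C], it is strictly above [b]; otherwise all three points lie in [A :\: C]
     and [S] decides. *)
  have strict e : e \in C -> asympart (f S) b e.
    move=> eC; rewrite /asympart fE bA eC orbT /= fB //.
    by apply/negP => /sSB/setXP[/= /sBC]; rewrite eC.
  case aC: (a \in C); first by rewrite strict.
  case cC: (c \in C); first by rewrite (strict c) ?orbT.
  have aB := inB a aA aC; have cB := inB c cA cC.
  by rewrite /asympart /sympart !fB //; apply: wsp.
Qed.

Lemma card_wsp_on_rec A m M : m \in A -> M \in A -> (m < M)%O ->
  {in A, forall x, (m <= x)%O && (x <= M)%O} ->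
  #|wsp_on A| = 1 + #|wsp_on (A :\ m)| + #|wsp_on (A :\ M)|
                  + #|wsp_on (A :\: [set m; M])|.
Proof.
move=> mA MA mM bnd.
have A0 : A != set0 by apply/set0Pn; exists m.
have nmM : m != M by rewrite lt_eqF.
have ext C a x c : C \subset [set m; M] -> a \in A -> x \in C -> c \in A ->
    (a < x)%O -> (x < c)%O -> False.
  move=> /subsetP sC aA /sC xmM cA ax xc.
  have /andP[ma _] := bnd a aA; have /andP[_ cM] := bnd c cA.
  move: xmM ax xc; rewrite !inE => /orP[]/eqP->.
    by rewrite ltNge ma.
  by rewrite [(M < c)%O]ltNge cM.
rewrite -(card_top_class_full A0) -(@card_top_class A [set m]); last first.
- by move=> a x c; apply: ext; rewrite sub1set !inE eqxx.
- by apply/properP; split; [rewrite sub1set | exists M; rewrite // inE eq_sym].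
- by apply/set0Pn; exists m; rewrite inE.
rewrite -(@card_top_class A [set M]); last first.
- by move=> a x c; apply: ext; rewrite sub1set !inE eqxx orbT.
- by apply/properP; split; [rewrite sub1set | exists m; rewrite // inE].
- by apply/set0Pn; exists M; rewrite inE.
(* When [A] is the pair itself, the maximal class [[set m; M]] is all of [A] and is counted by the
   first term. The extra conjunct avoids counting it twice, matching the value 0 on the empty
   set. *)
have -> : #|wsp_on (A :\: [set m; M])| =
    #|[set R in wsp_on A | (top_class A R == [set m; M]) && (A != [set m; M])]|.
  have sA : [set m; M] \subset A by rewrite subUset !sub1set mA MA.
  have [AE|nA] := eqVneq A [set m; M].
    rewrite {1}AE setDv wsp_on_set0 cards0; symmetry; apply/eqP.
    by rewrite cards_eq0; apply/eqP/setP => R; rewrite !inE andbF andbF.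
  rewrite -(@card_top_class A [set m; M]).
  - by apply: eq_card => R; rewrite !inE andbT.
  - by apply/set0Pn; exists m; rewrite !inE eqxx.
  - by rewrite properEneq eq_sym nA.
  - by move=> a x c; apply: ext.
have card_sum (P : pred {set T * T}) :
    #|[set R in wsp_on A | P R]| = \sum_(R in wsp_on A) P R.
  rewrite -sum1_card (eq_bigl (fun R => (R \in wsp_on A) && P R)).
    by rewrite big_mkcondr; apply: eq_bigr => R _; case: (P R).
  by move=> R; rewrite inE.
(* With cardinals as sums of indicators, it remains to see that each [R] falls in exactly one of the
   four cases. *)
rewrite !card_sum -!big_split -sum1_card /=; apply: eq_bigr => R RA.
have [topA|nA] := eqVneq (top_class A R) A.
  rewrite topA andbN !addn0.
  have -> : (A == [set m]) = false.
    by apply/eqP => AE; move: MA; rewrite AE inE eq_sym (negPf nmM).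
  suff -> : (A == [set M]) = false by [].
  by apply/eqP => AE; move: mA; rewrite AE inE (negPf nmM).
have sub : top_class A R \subset [set m; M].
  apply/subsetP => x xtop; have /top_classP[xA _] := xtop.
  rewrite !inE; apply/contraT; rewrite negb_or => /andP[xm xM].
  have /andP[mx Mx] := bnd x xA.
  case/eqP: nA; apply: (top_class_interior RA xtop mA MA).
    by rewrite lt_neqAle eq_sym xm.
  by rewrite lt_neqAle xM.
have neM : [set m] != [set M] by rewrite (inj_eq set1_inj).
have ne2m : [set m; M] != [set m].
  by apply/eqP => /setP/(_ M); rewrite !inE eqxx orbT eq_sym (negPf nmM).
have ne2M : [set m; M] != [set M].
  by apply/eqP => /setP/(_ m); rewrite !inE eqxx (negPf nmM).
move: nA; case/or3P: (subset2 (top_class_neq0 RA) sub) => /eqP-> nA.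
- by rewrite eqxx (negPf neM) [_ == [set m; M]]eq_sym (negPf ne2m).
- rewrite eqxx [_ == [set m]]eq_sym (negPf neM).
  by rewrite [_ == [set m; M]]eq_sym (negPf ne2M).
- by rewrite eqxx (negPf ne2m) (negPf ne2M) eq_sym nA.
Qed.

Lemma card_wsp_on1 x : #|wsp_on [set x]| = 1.
Proof.
have x0 : [set x] != set0 by apply/set0Pn; exists x; rewrite inE.
rewrite -(card_top_class_full x0); apply: eq_card => R; rewrite [RHS]inE.
case RW: (R \in wsp_on _) => //=; symmetry.
have : top_class [set x] R \subset [set x].
  by apply/subsetP => y /top_classP[].
by rewrite subset1 (negPf (top_class_neq0 RW)) orbF => ->.
Qed.

(** Removing one or both extreme points of [A] leaves subsets of size [#|A| - 1] or [#|A| - 2], so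
    strong induction on the size applies to all subsets at once. *)
Lemma card_wsp_on_recurrence (w : nat -> nat) : w 0 = 0 -> w 1 = 1 ->
  (forall n, w n.+2 = (w n.+1).*2 + w n + 1) ->
  forall A, #|wsp_on A| = w #|A|.
Proof.
move=> w0 w1 wS A; have [n] := ubnP #|A|; elim: n A => // n IHn A.
case cA: #|A| => [|[|k]] ltn.
- by move/eqP: cA; rewrite cards_eq0 => /eqP->; rewrite wsp_on_set0 cards0 w0.
- by have /cards1P[x ->] := introT eqP cA; rewrite card_wsp_on1 w1.
have /set0Pn[x0 x0A] : A != set0 by rewrite -cards_eq0 cA.
have [m mA mP] := arg_minP id x0A; have {}mA : m \in A := mA.
have [M MA MP] := arg_maxP id x0A; have {}MA : M \in A := MA.
have mM : (m < M)%O.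
  rewrite lt_neqAle mP // andbT; apply/eqP => mM.
  suff /subset_leq_card : A \subset [set m] by rewrite cA cards1 ltnS ltn0.
  apply/subsetP => x xA; rewrite inE eq_le mP //= andbT mM; exact: MP.
rewrite (card_wsp_on_rec mA MA mM); last first.
  by move=> x xA; apply/andP; split; [exact: mP | exact: MP].
have cm : #|A :\ m| = k.+1 by have := cardsD1 m A; rewrite mA cA => -[].
have cM : #|A :\ M| = k.+1 by have := cardsD1 M A; rewrite MA cA => -[].
have cmM : #|A :\: [set m; M]| = k.
  have := cardsD1 M (A :\ m).
  rewrite cm !inE MA (gt_eqF mM) /= => -[->].
  by apply: eq_card => x; rewrite !inE negb_or andbCA andbA.
by rewrite !IHn ?cm ?cM ?cmM ?wS; lia.
Qed.
End WeaklySinglePeakedOn.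

(** * The recurrence for [u] *)

Lemma u_card_wsp_on n : u n = #|wsp_on [set: 'I_n]|.
Proof.
case: n => [|n].
  have -> : [set: 'I_0] = set0 by apply/setP => -[].
  by rewrite wsp_on_set0 cards0.
by rewrite wsp_on_setT // -cards_eq0 cardsT card_ord.
Qed.

(** Carrying two consecutive values makes the second order recurrence a structural recursion. *)
Fixpoint u_pair (n : nat) : nat * nat :=
  if n is n'.+1 then let: (a, b) := u_pair n' in (b, b.*2 + a + 1) else (0, 1).

Lemma uE n : u n = (u_pair n).1.
Proof.
rewrite u_card_wsp_on.
rewrite (card_wsp_on_recurrence (w := fun n => (u_pair n).1)) ?cardsT ?card_ord //.
by move=> k /=; case: (u_pair k).
Qed.

Lemma u0 : u 0 = 0. Proof. by []. Qed.

Lemma u1 : u 1 = 1. Proof. by rewrite uE. Qed.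

Lemma uSS n : u n.+2 = (u n.+1).*2 + u n + 1.
Proof. by rewrite !uE /=; case: (u_pair n). Qed.

Local Open Scope ring_scope.

(** * Closed forms *)

Lemma big_ord_double (V : nmodType) (F : nat -> V) m :
  \sum_(i < m.*2) F i = \sum_(k < m) (F k.*2 + F k.*2.+1).
Proof.
elim: m => [|m IHm]; first by rewrite !big_ord0.
by rewrite doubleS !big_ord_recr /= IHm addrA.
Qed.

(** The odd powers of [s] cancel and the even ones double. The bound on [m] ensures that no binomial
    term is cut off. *)
Lemma exprDn_add_exprBn (K : comNzRingType) (s : K) n m : (n < m.*2)%N ->
  (1 + s) ^+ n + (1 - s) ^+ n = 2 * \sum_(k < m) 'C(n, k.*2)%:R * (s ^+ 2) ^+ k.
Proof.
move=> nm.
have expand (t : K) : (1 + t) ^+ n = \sum_(i < m.*2) 'C(n, i)%:R * t ^+ i.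
  rewrite exprDn (eq_bigr (fun i : 'I__ => 'C(n, i)%:R * t ^+ i)); last first.
    by move=> i _; rewrite expr1n mul1r mulr_natl.
  rewrite -(subnKC nm) big_split_ord /= [X in _ = _ + X]big1 ?addr0 // => i _.
  by rewrite bin_small ?mul0r // leq_addr.
rewrite !expand (big_ord_double (fun i => 'C(n, i)%:R * s ^+ i)).
rewrite (big_ord_double (fun i => 'C(n, i)%:R * (- s) ^+ i)) -big_split mulr_sumr.
apply: eq_bigr => k _ /=.
by rewrite (exprS s k.*2) (exprS (- s) k.*2) -mul2n !exprM sqrrN; ring.
Qed.

(** Both sides satisfy the homogeneous recurrence x(n+2) = 2 x(n+1) + x(n), so two consecutive
    values are carried through the induction. *)
Lemma u_closed_form (R : rcfType) n :
  2 * (u n)%:R + 1 =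
    2^-1 * (1 + Num.sqrt 2) ^+ n.+1 + 2^-1 * (1 - Num.sqrt 2) ^+ n.+1 :> R.
Proof.
have s2 : Num.sqrt 2 ^+ 2 = 2 :> R by rewrite sqr_sqrtr ?ler0n.
suff [] : 2 * (u n)%:R + 1 =
      2^-1 * (1 + Num.sqrt 2) ^+ n.+1 + 2^-1 * (1 - Num.sqrt 2) ^+ n.+1 :> R /\
    2 * (u n.+1)%:R + 1 =
      2^-1 * (1 + Num.sqrt 2) ^+ n.+2 + 2^-1 * (1 - Num.sqrt 2) ^+ n.+2 :> R.
  by [].
have two0 : (2 : R) != 0 by rewrite pnatr_eq0.
elim: n => [|n [IH0 IH1]].
  rewrite u0 u1; split; first by field.
  have -> : 2^-1 * (1 + Num.sqrt 2) ^+ 2 + 2^-1 * (1 - Num.sqrt 2) ^+ 2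
    = 1 + Num.sqrt 2 ^+ 2 :> R by field.
  by rewrite s2; ring.
split=> //.
(* Both numbers [1 + e], for [e] a square root of 2 of either sign, are roots of t^2 = 2 t + 1. *)
have rec (e : R) : e ^+ 2 = 2 -> (1 + e) ^+ n.+3 =
    2 * (1 + e) ^+ n.+2 + (1 + e) ^+ n.+1.
  move=> e2; have -> : (1 + e) ^+ n.+3 = (1 + 2 * e + e ^+ 2) * (1 + e) ^+ n.+1.
    by rewrite !exprS; ring.
  by rewrite e2 !exprS; ring.
rewrite !rec ?sqrrN //; move: IH0 IH1; rewrite uSS -addnn !natrD.
move=> IH0 IH1.
transitivity (2 * (2 * (u n.+1)%:R + 1) + (2 * (u n)%:R + 1) : R); first ring.
by rewrite IH0 IH1; ring.
Qed.

(** * The generating function *)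

(** Subtracting two successive instances of the recurrence removes the constant 1. On the
    denominator this is the factorisation 1 - 3z + z^2 + z^3 = (1 - z)(1 - 2z - z^2). *)
Lemma u_ogf_recurrence n : (u n.+4 + u n.+2 + u n.+1 = 3 * u n.+3)%N.
Proof. by have := uSS n.+2; have := uSS n.+1; lia. Qed.

(** Comparing coefficients in [D * v = 1] gives the initial values 1, 3, 8 and a third order
    recurrence for [v], both shared by the shifted sequence [u n.+1]. *)
Lemma fps_inv_denominator (K : fieldType) :
  fps_inv (fps_of_poly ('X^3 + 'X^2 - 3%:R *: 'X + 1 : {poly K}))
    =1 fun n => (u n.+1)%:R.
Proof.
set D := fps_of_poly _.
have DE i : D i = (i == 3)%:R + (i == 2)%:R - 3 * (i == 1)%:R + (i == 0)%:R.
  by rewrite /D /fps_of_poly !coefE.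
have D0 : D 0 = 1 by rewrite DE /=; ring.
have UD : D 0 \is a GRing.unit by rewrite D0 unitr1.
have D1 : D 1 = - 3 by rewrite DE /=; ring.
have D2 : D 2 = 1 by rewrite DE /=; ring.
have D3 : D 3 = 1 by rewrite DE /=; ring.
have conv n := fps_mulfV UD n; move: conv; rewrite /fps_mul.
set v := fps_inv D => conv.
have v0 : v 0 = 1.
  by have := conv 0; rewrite big_ord1 D0 mul1r /fps_of_poly coef1.
have v1 : v 1 = 3.
  have := conv 1; rewrite !big_ord_recr big_ord0 /= D0 D1 v0 /fps_of_poly coef1 /=.
  by move/eqP; rewrite add0r mul1r mulr1 subr_eq0 => /eqP.
have v2 : v 2 = 8.
  have := conv 2; rewrite !big_ord_recr big_ord0 /= D0 D1 D2 subSS subn0 v0 v1.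
  rewrite /fps_of_poly coef1 /= => e.
  transitivity (8 + (0 + 1 * v 2 + - 3 * 3 + 1 * 1) : K); first ring.
  by rewrite e addr0.
have vS n : v n.+3 = 3 * v n.+2 - v n.+1 - v n.
  (* [D] has degree 3, so only the first four terms of the convolution survive. *)
  have := conv n.+3; rewrite !big_ord_recl big1 => [|i _]; last first.
    by rewrite DE /=; ring.
  rewrite /bump /= !subSS !subn0 D0 D1 D2 D3 /fps_of_poly coef1 /= => e.
  transitivity (3 * v n.+2 - v n.+1 - v n +
    (1 * v n.+3 + (- 3 * v n.+2 + (1 * v n.+1 + (1 * v n + 0))))); first ring.
  by rewrite e addr0.
move=> n; suff [] : [/\ v n = (u n.+1)%:R, v n.+1 = (u n.+2)%:R
  & v n.+2 = (u n.+3)%:R] by [].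
elim: n => [|n [IH0 IH1 IH2]]; first by rewrite v0 v1 v2 !uE.
split=> //; rewrite vS IH0 IH1 IH2.
have /(congr1 (fun k => k%:R : K)) := u_ogf_recurrence n.
by rewrite natrM !natrD => <-; ring.
Qed.

(* 'C(n.+1, k.*2) vanishes for k > n + 1, so the sum over all k >= 0 is the
   sum over k < n + 2. *)
Theorem proposition4p8 (R : rcfType) :
  [/\ u 0%N = 0%N,
      u 1%N = 1%N,
      forall n : nat,
        (u n.+2)%:Z - 2 * (u n.+1)%:Z - (u n)%:Z = 1,
      forall n : nat,
        2 * (u n)%:R + 1 =
          2^-1 * (1 + Num.sqrt 2) ^+ n.+1 + 2^-1 * (1 - Num.sqrt 2) ^+ n.+1 :> R
        /\
        2^-1 * (1 + Num.sqrt 2) ^+ n.+1 + 2^-1 * (1 - Num.sqrt 2) ^+ n.+1 =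
          \sum_(k < n.+2) ('C(n.+1, k.*2))%:R * 2 ^+ k :> R
    & ogf R u =1
        fps_div (fps_of_poly 'X)
                (fps_of_poly ('X^3 + 'X^2 - 3%:R *: 'X + 1))].
Proof.
split; [exact: u0 | exact: u1 | by move=> n; have := uSS n; lia | |].
  move=> n; split; first exact: u_closed_form.
  rewrite -mulrDr (exprDn_add_exprBn _ (m := n.+2)); last by lia.
  by rewrite mulKf ?pnatr_eq0 // sqr_sqrtr ?ler0n.
case=> [|n]; rewrite /ogf /fps_div /fps_mul.
  by rewrite big_ord1 /fps_of_poly coefX mul0r.
(* Multiplying by ['X] keeps only the term of index 1, which shifts the coefficients and cancels the
   shift in [u n.+1]. *)
rewrite 2!big_ord_recl big1 => [|i _]; last by rewrite /fps_of_poly coefX mul0r.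
rewrite /fps_of_poly !coefX /= mul0r mul1r add0r addr0 subSS subn0.
by rewrite fps_inv_denominator.
Qed.
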